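(* Assume the cost conventions (C1)–(C3) given in the context, and assume that, for all $k\in\mathbb N$, the number $\rho_k$ of iSCD-MPC iterations at step $k$ satisfies $$\rho_k\le\min\left\{\rho,\ 2+\max\left\{0,\ \left\lfloor\frac{\ln(\varepsilon/\|U_{k|2}-U_{k|1}\|)}{\ln\gamma}\right\rfloor+1\right\}\right\},\qquad \gamma\in(0,1).$$ Then, for all $k\in\mathbb N$, the per-step operation counts satisfy: (i) $C_{\rm iSCD}=O\big(\ell(n+m)^3\log(1/\varepsilon)\big)$; (ii) $C_{\rm iLQR}=O\big(\ell(n+m)^3\log(1/\varepsilon)\big)+C_{\rm Jac}$; (iii) $C_{\rm SQP}=O\big(\ell^3(n+m)^3\log(1/\varepsilon)\big)$; (iv) $C_{\rm LPV}=O\big(\ell(n+m)^3\big)$.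
   Context: $n$ is the state dimension, $m$ the control dimension, $\ell\ge2$ the horizon length, $\varepsilon\in(0,\infty)$ the tolerance to which the inner optimization is solved, $\rho$ the maximum number of iterations. The plant is $x_{k+1}=f(x_k,u_k)$, $f(x,u)=A(x,u)x+B(x,u)u$ with $A(x,u)\in\mathbb R^{n\times n}$, $B(x,u)\in\mathbb R^{n\times m}$. $J_f=[\nabla_xf\ \ \nabla_uf]$ is the Jacobian. Cost model (floating-point operations): (C1) Solving one quadratic program in $N$ decision variables by an interior-point method costs $O(N^3)$ when the Karush-Kuhn-Tucker matrix is treated as dense, and $O(\ell(n+m)^3)$ when that matrix is block banded with $\ell$ diagonal blocks of order $n+m$ and is factored by the corresponding Riccati recursion. The number of interior-point iterations is bounded by a constant independent of $\ell,n,m$ and is absorbed into these costs. (C2) The number of outer iterations required to reach tolerance $\varepsilon$ (the iterations $\rho_k$ for iSCD-MPC and the Newton-type iterations for iLQR and SQP) is $O(\log(1/\varepsilon))$. (C3) Let $C_f$ be the cost of one evaluation of $f$. Evaluating $J_f$ by finite differences requires $n+m$ evaluations of $f$ and costs $O((n+m)C_f)$ per stage. For the form $f(x,u)=A(x,u)x+B(x,u)u$, $C_f=O(n^2+nm)=O(n(n+m))$, so a finite-difference Jacobian costs $O(n(n+m)^2)$ per stage. Methods, at each step $k$: - iSCD-MPC (cost $C_{\rm iSCD}$): each iteration $i\ge2$ rolls out $f$ from $x_{k,1}=f(x_k,u_k)$ over the horizon under the previous control iterate $U_{k|i-1}$, evaluates $A,B$ at each of the $\ell-1$ stages along it to obtain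 frozen coefficients $A_{k,j|i-1},B_{k,j|i-1}$, and solves one quadratic program in states $\xi_1,\ldots,\xi_\ell$ and controls $\mu_1,\ldots,\mu_{\ell-1}$ with quadratic stage and terminal cost, dynamics $\xi_{j+1}=A_{k,j|i-1}\xi_j+B_{k,j|i-1}\mu_j$ and linear constraints, keeping the block-banded structure, to obtain $U_{k|i}$; it stops at $\rho_k$, the first $i\in\{2,\ldots,\rho\}$ with $\|U_{k|i}-U_{k|i-1}\|<\varepsilon$, or $\rho$ if there is none. - iLQR (cost $C_{\rm iLQR}$): each iteration performs a Jacobian linearization, a backward Riccati pass factoring the same block-banded structure, and a line-searched forward rollout; $C_{\rm Jac}$ denotes the operations spent by iLQR at step $k$ on Jacobian evaluation and line search. - Dense SQP (cost $C_{\rm SQP}$): each outer iteration solves a quadratic program whose Karush-Kuhn-Tucker system in the $N=O(\ell(n+m))$ state and control variables is treated as dense, without exploiting block-banded sparsity (or equivalently condenses the states out at cubic horizon cost). - LPV-MPC (cost $C_{\rm LPV}$): freezes the coefficients at the current operating point, $(A_{k,j|i},B_{k,j|i})\equiv(A(x_k,u_k),B(x_k,u_k))$ for all $j$, and solves a single quadratic program of the same block-banded structure per step. *)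

(* Defs.v *)
From mathcomp Require Export all_boot all_order all_algebra.
From mathcomp Require Export all_classical all_reals all_analysis.
Export Order.TTheory GRing.Theory Num.Theory.
Export numFieldNormedType.Exports.

Set Implicit Arguments.
Unset Strict Implicit.
Unset Printing Implicit Defensive.

Local Open Scope classical_set_scope.
Local Open Scope ring_scope.

(* Horizon sequences are indexed from 1, states by 1 <= j <= l and controls by
   1 <= j < l; they are functions on nat whose other values are never read. *)

(* Cost and constraints of a horizon problem; every term involves the state and
   control of a single stage, so that the KKT matrix is block banded. *)
Record horizon_data (R : realType) (n m : nat) := HorizonData {
  stage_quad : nat -> 'M[R]_(n + m);
  stage_lin : nat -> 'cV[R]_(n + m);
  term_quad : 'M[R]_n;
  term_lin : 'cV[R]_n;
  stage_nc : nat;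
  stage_cmx : nat -> 'M[R]_(stage_nc, n + m);
  stage_cub : nat -> 'cV[R]_stage_nc;
  term_nc : nat;
  term_cmx : 'M[R]_(term_nc, n);
  term_cub : 'cV[R]_term_nc }.

Definition quad_fun (R : realType) d (H : 'M[R]_d) (g z : 'cV[R]_d) : R :=
  (z^T *m H *m z + g^T *m z) 0 0.

Section QuadraticProgram.
Variables (R : realType) (n m l : nat) (h : horizon_data R n m).
Variables (A : nat -> 'M[R]_n) (B : nat -> 'M[R]_(n, m)) (x1 : 'cV[R]_n).

Definition qp_cost (xi : nat -> 'cV[R]_n) (mu : nat -> 'cV[R]_m) : R :=
  \sum_(1 <= j < l)
     quad_fun (stage_quad h j) (stage_lin h j) (col_mx (xi j) (mu j))
  + quad_fun (term_quad h) (term_lin h) (xi l).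

Definition qp_feasible (xi : nat -> 'cV[R]_n) (mu : nat -> 'cV[R]_m) : Prop :=
  [/\ xi 1%N = x1,
      forall j, (1 <= j < l)%N -> xi j.+1 = A j *m xi j + B j *m mu j,
      forall j, (1 <= j < l)%N -> forall a,
        (stage_cmx h j *m col_mx (xi j) (mu j)) a 0 <= stage_cub h j a 0
    & forall a, (term_cmx h *m xi l) a 0 <= term_cub h a 0].

Definition qp_solution (xi : nat -> 'cV[R]_n) (mu : nat -> 'cV[R]_m) : Prop :=
  qp_feasible xi mu /\
  forall xi' mu', qp_feasible xi' mu' -> qp_cost xi mu <= qp_cost xi' mu'.

End QuadraticProgram.

(* Euclidean norm of the stacked control sequence (U_1, ..., U_(l-1)). *)
Definition ctrl_norm (R : realType) (m l : nat) (U : nat -> 'cV[R]_m) : R :=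
  Num.sqrt (\sum_(1 <= j < l) \sum_(a < m) U j a 0 ^+ 2).

(* Operation counts of the solvers: [qp_dense N] for a quadratic program in N
   variables with dense KKT matrix; [qp_banded l d] for one with l diagonal
   blocks of order d, and [riccati l d] for a single Riccati factorization of
   the latter KKT matrix. *)
Record solver_costs := SolverCosts {
  qp_dense : nat -> nat;
  qp_banded : nat -> nat -> nat;
  riccati : nat -> nat -> nat }.

(* A control problem with the data of the runs of the four methods. The maps on
   nat are indexed by the step k; [iterate k i j] is the j-th control of the
   iSCD-MPC iterate U_{k|i}, whose initial value U_{k|1} is an input. *)
Record mpc (R : realType) := MPC {
  state_dim : nat;
  ctrl_dim : nat;
  horizon : nat;
  tol : R;
  max_iter : nat;
  plantA : 'cV[R]_state_dim -> 'cV[R]_ctrl_dim -> 'M[R]_state_dim;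
  plantB : 'cV[R]_state_dim -> 'cV[R]_ctrl_dim -> 'M[R]_(state_dim, ctrl_dim);
  state : nat -> 'cV[R]_state_dim;
  ctrl : nat -> 'cV[R]_ctrl_dim;
  problem : nat -> horizon_data R state_dim ctrl_dim;
  iterate : nat -> nat -> nat -> 'cV[R]_ctrl_dim;
  f_cost : nat;      (* one evaluation of the plant map *)
  AB_cost : nat;     (* one evaluation of plantA and plantB *)
  jac_cost : nat;    (* one finite-difference Jacobian of the plant map *)
  ilqr_iters : nat -> nat;
  linesearch_cost : nat -> nat -> nat;   (* indexed by step and iteration *)
  sqp_iters : nat -> nat;
  sqp_vars : nat }.

Section Methods.
Variables (R : realType) (c : solver_costs) (p : mpc R).

Definition plant (y : 'cV[R]_(state_dim p)) (v : 'cV[R]_(ctrl_dim p)) :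
    'cV[R]_(state_dim p) :=
  plantA y v *m y + plantB y v *m v.

Fixpoint rollout (x1 : 'cV[R]_(state_dim p))
    (V : nat -> 'cV[R]_(ctrl_dim p)) (j : nat) :=
  if j is (j'.+1 as i).+1 then plant (rollout x1 V i) (V i) else x1.

(* x_{k,j} along U_{k|i} *)
Definition pred_state (k i j : nat) : 'cV[R]_(state_dim p) :=
  rollout (plant (state p k) (ctrl p k)) (iterate p k i) j.

Definition increment (k i : nat) : R :=
  ctrl_norm (horizon p) (fun j => iterate p k i j - iterate p k i.-1 j).

Definition rho_at (k : nat) : nat :=
  head (max_iter p) [seq i <- iota 2 (max_iter p).-1 | increment k i < tol p].

Definition iscd_step (k i : nat) : Prop :=
  exists xi, qp_solution (horizon p) (problem p k)
    (fun j => plantA (pred_state k i.-1 j) (iterate p k i.-1 j))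
    (fun j => plantB (pred_state k i.-1 j) (iterate p k i.-1 j))
    (plant (state p k) (ctrl p k)) xi (iterate p k i).

Definition mpc_run : Prop :=
  [/\ [/\ (0 < state_dim p)%N, (0 < ctrl_dim p)%N, (2 <= horizon p)%N & 0 < tol p],
      forall k, state p k.+1 = plant (state p k) (ctrl p k)
    & forall k i, (2 <= i <= rho_at k)%N -> iscd_step k i].

(* When U_{k|2} = U_{k|1}, ln (tol / 0) / ln gamma stands for -oo and the
   maximum is 0, whereas tol / 0 = 0 and ln 0 = 0 in the library. *)
Definition iter_bound (gamma : R) (k : nat) : int :=
  Num.min (max_iter p)%:Z
    (2 + if increment k 2 == 0 then 0
         else Num.max 0 (Num.floor (ln (tol p / increment k 2) / ln gamma) + 1)).

Definition dim := (state_dim p + ctrl_dim p)%N.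

Definition C_iSCD (k : nat) : nat :=
  (f_cost p +
   \sum_(2 <= i < (rho_at k).+1)
      (\sum_(1 <= j < horizon p) f_cost p + \sum_(1 <= j < horizon p) AB_cost p
       + qp_banded c (horizon p) dim))%N.

Definition C_iLQR (k : nat) : nat :=
  (\sum_(1 <= i < (ilqr_iters p k).+1)
      (\sum_(1 <= j < horizon p) jac_cost p + riccati c (horizon p) dim
       + linesearch_cost p k i))%N.

Definition C_Jac (k : nat) : nat :=
  (\sum_(1 <= i < (ilqr_iters p k).+1)
      (\sum_(1 <= j < horizon p) jac_cost p + linesearch_cost p k i))%N.

(* The quadratic program is the linearization of the dynamics, which is charged
   as well. *)
Definition C_SQP (k : nat) : nat :=
  (\sum_(1 <= i < (sqp_iters p k).+1)
      (\sum_(1 <= j < horizon p) jac_cost p + qp_dense c (sqp_vars p)))%N.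

(* The initial state f(x_k, u_k) of the quadratic program is charged as well. *)
Definition C_LPV (k : nat) : nat :=
  (f_cost p + AB_cost p + qp_banded c (horizon p) dim)%N.

End Methods.

Canonical globally_filter_on (T : Type) (S : set T) :=
  FilterType (globally S) (globally_filter S).

Section Asymptotics.
Variables (R : realType) (D : set (mpc R)).

(* tol -> 0+, uniformly in the other parameters of the problems of D *)
Definition small_tol : set_system (mpc R) :=
  [set P | \forall e \near 0^'+, forall p, D p -> tol p = e -> P p].

Global Instance small_tol_filter : Filter small_tol.
Proof.
constructor.
- by rewrite /small_tol /=; near=> e.
- move=> P Q; rewrite /small_tol /= => hP hQ; near=> e => p Dp ep.
  by split; [exact: (near hP e)|exact: (near hQ e)].
- move=> P Q PQ; rewrite /small_tol /= => hP; near=> e => p Dp ep.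
  by apply: PQ; exact: (near hP e).
Unshelve. all: by end_near.
Qed.

Canonical small_tol_filter_on := FilterType small_tol small_tol_filter.

(* The interior-point iterations are absorbed in [qp_dense] and [qp_banded];
   there is at least one, hence one factorization is no dearer than a solve. *)
Definition cost_C1 (c : solver_costs) : Prop :=
  [/\ (fun N => (qp_dense c N)%:R : R^o) =O_ (globally [set: nat])
        (fun N => (N ^ 3)%:R : R^o),
      (fun q : nat * nat => (qp_banded c q.1 q.2)%:R : R^o)
        =O_ (globally [set: nat * nat]) (fun q => (q.1 * q.2 ^ 3)%:R : R^o)
    & forall l d, (riccati c l d <= qp_banded c l d)%N].

Definition log_iters (N : mpc R -> nat) : Prop :=
  (fun p => (N p)%:R : R^o) =O_small_tol (fun p => ln (1 / tol p) : R^o).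

Definition cost_C2 : Prop :=
  forall k, [/\ log_iters (fun p => rho_at p k),
                log_iters (fun p => ilqr_iters p k)
              & log_iters (fun p => sqp_iters p k)].

(* f is evaluated by evaluating A and B first, hence the last clause. *)
Definition cost_C3 : Prop :=
  [/\ (fun p : mpc R => (jac_cost p)%:R : R^o)
        =O_ (globally D) (fun p => (dim p * f_cost p)%:R : R^o),
      (fun p : mpc R => (f_cost p)%:R : R^o)
        =O_ (globally D) (fun p => (state_dim p * dim p)%:R : R^o)
    & forall p, D p -> (AB_cost p <= f_cost p)%N].

End Asymptotics.

(* Main.v *)
Require Import Defs.

(** Up to single evaluations, each count is a number of iterations (one, for
    LPV-MPC) times the cost of an iteration. The cost of an iteration is
    compared with a monomial in the horizon l and the stage order d = n + m,
    uniformly over all problems of the class; the number of iterations is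
    O(ln (1 / tol)) as the tolerance tends to 0; the two estimates are then
    multiplied ([bigO_iterated]).

    One evaluation of f costs O(n d) = O(d^2), hence one finite-difference
    Jacobian O(d^3), so that a rollout over the horizon and a pass of Jacobian
    evaluations are both O(l d^3) ([rollout_cost_bigO], [jac_pass_cost_bigO]).
    They are thus absorbed by a banded quadratic program, of cost O(l d^3), and
    a fortiori by a dense one, of cost O((l d)^3). This settles an iteration of
    iSCD-MPC and of dense SQP, and the single pass of LPV-MPC. For iLQR the
    Jacobians and the line search are exactly C_Jac, and what remains of each
    iteration is one Riccati factorization, no dearer than a banded solve.

    The evaluation of f(x_k, u_k) that precedes the iSCD-MPC iterations carries
    no factor ln (1 / tol); it is absorbed because that factor is at least 1 for
    small tolerances ([small_tol_ln_ge1]). *)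

Set Implicit Arguments.
Unset Strict Implicit.
Unset Printing Implicit Defensive.

Local Open Scope classical_set_scope.
Local Open Scope ring_scope.

(** * Closure properties of O along a filter *)

Section BigO.
Variables (R : realType) (T : Type).
Implicit Types (F : filter_on T) (f g h : T -> R^o).

Lemma bigO_dominated F f g h :
  (\forall x \near F, `|f x| <= `|g x|) -> g =O_F h -> f =O_F h.
Proof.
move=> fg /eqO_exP[K K0 gh]; apply/eqO_exP; exists K => //.
by apply: filterS2 fg gh => x; exact: le_trans.
Qed.

Lemma bigO_trans F f g h : f =O_F g -> g =O_F h -> f =O_F h.
Proof.
move=> /eqO_exP[K K0 fg] /eqO_exP[L L0 gh]; apply/eqO_exP.
exists (K * L); first exact: mulr_gt0.
apply: filterS2 fg gh => x fg gh; apply: le_trans fg _.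
by rewrite -mulrA ler_wpM2l// ltW.
Qed.

Lemma bigO_add F f g h : f =O_F h -> g =O_F h -> (fun x => f x + g x) =O_F h.
Proof.
move=> /eqO_exP[K K0 fh] /eqO_exP[L L0 gh]; apply/eqO_exP.
exists (K + L); first exact: addr_gt0.
apply: filterS2 fh gh => x fh gh; rewrite mulrDl.
by apply: le_trans (ler_normD _ _) _; exact: lerD.
Qed.

Lemma bigO_mul F f1 f2 g1 g2 : f1 =O_F g1 -> f2 =O_F g2 ->
  (fun x => f1 x * f2 x : R^o) =O_F (fun x => g1 x * g2 x : R^o).
Proof.
move=> /eqO_exP[K K0 fg1] /eqO_exP[L L0 fg2]; apply/eqO_exP.
exists (K * L); first exact: mulr_gt0.
apply: filterS2 fg1 fg2 => x fg1 fg2.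
by rewrite !normrM mulrACA; exact: ler_pM.
Qed.

(** A bound over a full index set is a uniform inequality, so it survives any
    substitution: this turns a bound in terms of the size of a quadratic program
    into one in terms of the problem that gives rise to it. *)
Lemma bigO_comp (I : Type) F (u : T -> I) (f g : I -> R^o) :
  f =O_ (globally [set: I]) g -> (fun x => f (u x)) =O_F (fun x => g (u x)).
Proof.
move=> /eqO_exP[K K0 fg]; apply/eqO_exP; exists K => //.
by apply: filterE => x; exact: fg.
Qed.

Lemma bigO_natW F (N M : T -> nat) h :
  (\forall x \near F, (N x <= M x)%N) ->
  (fun x => (M x)%:R : R^o) =O_F h -> (fun x => (N x)%:R : R^o) =O_F h.
Proof.
move=> NM; apply: bigO_dominated; apply: filterS NM => x NM.
by rewrite !normr_nat ler_nat.
Qed.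

Lemma bigO_natD F (N M : T -> nat) h :
  (fun x => (N x)%:R : R^o) =O_F h -> (fun x => (M x)%:R : R^o) =O_F h ->
  (fun x => (N x + M x)%:R : R^o) =O_F h.
Proof.
move=> Nh Mh; under eq_fun do rewrite natrD.
exact: bigO_add.
Qed.

Lemma bigO_natM F (N1 N2 M1 M2 : T -> nat) :
  (fun x => (N1 x)%:R : R^o) =O_F (fun x => (M1 x)%:R : R^o) ->
  (fun x => (N2 x)%:R : R^o) =O_F (fun x => (M2 x)%:R : R^o) ->
  (fun x => (N1 x * N2 x)%:R : R^o) =O_F (fun x => (M1 x * M2 x)%:R : R^o).
Proof.
move=> h1 h2; under eq_fun do rewrite natrM.
apply: bigO_trans (bigO_mul h1 h2) _; apply: bigO_dominated (idO _ _).
by apply: filterE => x; rewrite natrM.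
Qed.

Lemma bigO_nat_le F (N M : T -> nat) :
  (\forall x \near F, (N x <= M x)%N) ->
  (fun x => (N x)%:R : R^o) =O_F (fun x => (M x)%:R : R^o).
Proof. by move=> /bigO_natW; apply; exact: idO. Qed.

End BigO.

(** * From uniform bounds to bounds for small tolerances *)

Section SmallTolerance.
Variables (R : realType) (D : set (mpc R)).

Lemma small_tol_globally (P : set (mpc R)) : globally D P -> small_tol D P.
Proof.
move=> DP; rewrite /small_tol/=; near=> e => p Dp _; exact: DP.
Unshelve. all: by end_near. Qed.

Lemma bigO_small_tol (f g : mpc R -> R^o) :
  f =O_ (globally D) g -> f =O_ (small_tol D) g.
Proof.
move=> /eqO_exP[K K0 fg]; apply/eqO_exP; exists K => //.
exact: small_tol_globally.
Qed.

Lemma small_tol_ln_ge1 : \forall p \near small_tol D, 1 <= ln (1 / tol p).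
Proof.
(* the threshold is exp(-1), where the logarithm reaches 1 *)
rewrite nearE /small_tol/=; near=> e => p _ ->.
have e0 : 0 < e by near: e; exact: nbhs_right_gt.
rewrite div1r -[leLHS](@expRK R) ler_ln ?posrE ?expR_gt0 ?invr_gt0//.
rewrite -[leLHS]invrK lef_pV2 ?posrE ?invr_gt0 ?expR_gt0//.
by near: e; apply: nbhs_right_le; rewrite invr_gt0 expR_gt0.
Unshelve. all: by end_near. Qed.

(** The logarithm is at least 1 for small tolerances, so work done outside the
    iterations is absorbed by work done in them. *)
Lemma bigO_once (W V : mpc R -> nat) :
  (fun p => (W p)%:R : R^o) =O_ (globally D) (fun p => (V p)%:R : R^o) ->
  (fun p => (W p)%:R : R^o)
    =O_ (small_tol D) (fun p => (V p)%:R * ln (1 / tol p) : R^o).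
Proof.
move=> /bigO_small_tol WV; apply: bigO_trans WV _.
apply: bigO_dominated (idO _ _).
apply: filterS small_tol_ln_ge1 => p ln1.
by rewrite normrM ler_peMr// (le_trans ln1)// ler_norm.
Qed.

Lemma bigO_iterated (N W V : mpc R -> nat) : log_iters D N ->
  (fun p => (W p)%:R : R^o) =O_ (globally D) (fun p => (V p)%:R : R^o) ->
  (fun p => (N p * W p)%:R : R^o)
    =O_ (small_tol D) (fun p => (V p)%:R * ln (1 / tol p) : R^o).
Proof.
move=> Nln /bigO_small_tol WV.
under eq_fun do rewrite mulnC natrM.
exact: bigO_mul.
Qed.

End SmallTolerance.

(** * Cost of one iteration *)

Section Costs.
Variables (R : realType) (c : solver_costs) (D : set (mpc R)).
Hypothesis hD : forall p, D p -> mpc_run p.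
Hypothesis hC1 : cost_C1 R c.
Hypothesis hC3 : cost_C3 D.

Lemma dim_gt0 p : D p -> (0 < dim p)%N.
Proof. by move=> /hD[[n0 _ _ _] _ _]; rewrite addn_gt0 n0. Qed.

Lemma horizon_gt0 p : D p -> (0 < horizon p)%N.
Proof. by move=> /hD[[_ _ l2 _] _ _]; exact: ltnW. Qed.

Lemma f_cost_bigO :
  (fun p : mpc R => (f_cost p)%:R : R^o)
    =O_ (globally D) (fun p => (dim p ^ 2)%:R : R^o).
Proof.
have [_ fO _] := hC3; apply: bigO_trans fO _.
by apply: bigO_nat_le => p _; rewrite expnS expn1 leq_mul// leq_addr.
Qed.

(** The estimate for f has a factor d to spare, since d >= 1; this puts a rollout
    on the scale of a banded solve. *)
Lemma rollout_cost_bigO :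
  (fun p : mpc R => (horizon p * f_cost p)%:R : R^o)
    =O_ (globally D) (fun p => (horizon p * dim p ^ 3)%:R : R^o).
Proof.
apply: bigO_natM; first exact: idO.
apply: bigO_trans f_cost_bigO _.
by apply: bigO_nat_le => p Dp; rewrite leq_pexp2l// dim_gt0.
Qed.

(** Finite differences cost d evaluations of f per stage, which uses up exactly
    the factor d by which f is cheaper than a diagonal block of a solve. *)
Lemma jac_pass_cost_bigO :
  (fun p : mpc R => (horizon p * jac_cost p)%:R : R^o)
    =O_ (globally D) (fun p => (horizon p * dim p ^ 3)%:R : R^o).
Proof.
apply: bigO_natM; first exact: idO.
have [jacO _ _] := hC3; apply: bigO_trans jacO _.
apply: bigO_trans (bigO_natM (idO _ _) f_cost_bigO) _.
by apply: bigO_nat_le => p _; rewrite -expnS.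
Qed.

Lemma qp_banded_bigO :
  (fun p : mpc R => (qp_banded c (horizon p) (dim p))%:R : R^o)
    =O_ (globally D) (fun p => (horizon p * dim p ^ 3)%:R : R^o).
Proof.
have [_ bandedO _] := hC1.
exact: (bigO_comp _ (fun p : mpc R => (horizon p, dim p)) bandedO).
Qed.

Lemma qp_dense_bigO :
  (fun p : mpc R => (sqp_vars p)%:R : R^o)
    =O_ (globally D) (fun p => (horizon p * dim p)%:R : R^o) ->
  (fun p : mpc R => (qp_dense c (sqp_vars p))%:R : R^o)
    =O_ (globally D) (fun p => (horizon p ^ 3 * dim p ^ 3)%:R : R^o).
Proof.
move=> varsO; have [denseO _ _] := hC1.
apply: bigO_trans (bigO_comp _ (fun p : mpc R => sqp_vars p) denseO) _.
apply: bigO_trans (bigO_natM varsO (bigO_natM varsO varsO)) _.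
by apply: bigO_nat_le => p _; rewrite -expnMn.
Qed.

Lemma iscd_iter_bigO :
  (fun p : mpc R => (\sum_(1 <= j < horizon p) f_cost p
      + \sum_(1 <= j < horizon p) AB_cost p
      + qp_banded c (horizon p) (dim p))%:R : R^o)
    =O_ (globally D) (fun p => (horizon p * dim p ^ 3)%:R : R^o).
Proof.
have [_ _ AB_f] := hC3.
apply: bigO_natD qp_banded_bigO.
apply: bigO_natD; apply: bigO_natW rollout_cost_bigO => p Dp.
  by rewrite sum_nat_const_nat leq_mul// leq_subr.
by rewrite sum_nat_const_nat leq_mul ?leq_subr ?AB_f.
Qed.

Lemma sqp_iter_bigO :
  (fun p : mpc R => (sqp_vars p)%:R : R^o)
    =O_ (globally D) (fun p => (horizon p * dim p)%:R : R^o) ->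
  (fun p : mpc R => (\sum_(1 <= j < horizon p) jac_cost p
      + qp_dense c (sqp_vars p))%:R : R^o)
    =O_ (globally D) (fun p => (horizon p ^ 3 * dim p ^ 3)%:R : R^o).
Proof.
move=> /qp_dense_bigO; apply: bigO_natD.
apply: (@bigO_natW _ _ _ _ (fun p => horizon p * jac_cost p)%N) => [p _|].
  by rewrite sum_nat_const_nat leq_mul// leq_subr.
apply: bigO_trans jac_pass_cost_bigO _; apply: bigO_nat_le => p Dp.
by rewrite leq_mul// -[leqLHS]expn1 leq_pexp2l// horizon_gt0.
Qed.

(** A rollout has at least one stage, hence dominates a single evaluation. *)
Lemma f_cost_once_bigO :
  (fun p : mpc R => (f_cost p)%:R : R^o)
    =O_ (globally D) (fun p => (horizon p * dim p ^ 3)%:R : R^o).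
Proof.
apply: bigO_natW rollout_cost_bigO => p Dp.
by rewrite leq_pmull// horizon_gt0.
Qed.

End Costs.

(** No bound on the line search is assumed, so it has to cancel exactly: both
    sums run over the same iterations and differ by one factorization in each. *)
Lemma C_iLQR_split (R : realType) (c : solver_costs) (p : mpc R) k :
  C_iLQR c p k = (C_Jac p k + ilqr_iters p k * riccati c (horizon p) (dim p))%N.
Proof.
rewrite /C_iLQR /C_Jac; under eq_bigr do rewrite addnAC.
by rewrite big_split/= [X in (_ + X)%N]sum_nat_const_nat subn1.
Qed.

(** * Cost of one step *)

(* D is the class of problems over which the operation counts are compared. *)
Theorem proposition10 (R : realType) (c : solver_costs) (D : set (mpc R))
    (gamma : mpc R -> R)
    (hD : forall p, D p -> mpc_run p)
    (hgamma : forall p, D p -> 0 < gamma p < 1)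
    (hC1 : cost_C1 R c) (hC2 : cost_C2 D) (hC3 : cost_C3 D)
    (hN : (fun p : mpc R => (sqp_vars p)%:R : R^o)
            =O_ (globally D) (fun p => (horizon p * dim p)%:R : R^o))
    (hrho : forall k p, D p -> (rho_at p k)%:Z <= iter_bound p (gamma p) k) :
  forall k,
    [/\ (fun p : mpc R => (C_iSCD c p k)%:R : R^o) =O_ (small_tol D)
          (fun p => (horizon p * dim p ^ 3)%:R * ln (1 / tol p) : R^o),
        (fun p : mpc R => (C_iLQR c p k)%:R : R^o)
          = (fun p => (C_Jac p k)%:R : R^o) +O_ (small_tol D)
          (fun p => (horizon p * dim p ^ 3)%:R * ln (1 / tol p) : R^o),
        (fun p : mpc R => (C_SQP c p k)%:R : R^o) =O_ (small_tol D)
          (fun p => (horizon p ^ 3 * dim p ^ 3)%:R * ln (1 / tol p) : R^o)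
      & (fun p : mpc R => (C_LPV c p k)%:R : R^o) =O_ (globally D)
          (fun p => (horizon p * dim p ^ 3)%:R : R^o)].
Proof.
move=> k; have [rhoO ilqrO sqpO] := hC2 k; split.
- apply: bigO_natD; first exact/bigO_once/f_cost_once_bigO.
  apply: bigO_natW (bigO_iterated rhoO (iscd_iter_bigO hD hC1 hC3)).
  by apply: filterE => p; rewrite sum_nat_const_nat subSS leq_mul// leq_subr.
- have riccatiO : (fun p : mpc R => (riccati c (horizon p) (dim p))%:R : R^o)
      =O_ (globally D) (fun p => (horizon p * dim p ^ 3)%:R : R^o).
    by apply: bigO_natW (qp_banded_bigO D hC1) => p _; case: hC1.
  apply/eqaddOP; have /eqOP := bigO_iterated ilqrO riccatiO.
  apply: filterS => K; apply: filterS => p; congr (`|_| <= _).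
  by rewrite -[RHS]/(_%:R - _%:R) C_iLQR_split natrD addrAC subrr add0r.
- apply: bigO_natW (bigO_iterated sqpO (sqp_iter_bigO hD hC1 hC3 hN)).
  by apply: filterE => p; rewrite /C_SQP sum_nat_const_nat subn1.
- have [_ _ AB_f] := hC3.
  apply: bigO_natD (qp_banded_bigO D hC1).
  have fO := f_cost_once_bigO hD hC3.
  by apply: bigO_natD => //; apply: bigO_natW fO => p /AB_f.
Qed.
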